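(* Put $G=\{\pm1\}$ and $H=\{1\}$. Let $\rho\colon\{\pm1\}\to\mathbb{R}^\times=GL(\mathbb{R})$ be the signature representation. Then $v_0:=1\in\mathbb{R}$ is $H$-fixed, and the family $\mathcal{P}$ obtained from $(G,H,\mathbb{R},v_0)$ by the method described in the context is the family of Bernoulli distributions on $G/H=\{\pm1\}$, $$\left\{s^{\frac{1+x}{2}}(1-s)^{\frac{1-x}{2}}\,dc(x)\right\}_{s\in(0,1)}\qquad(x\in\{-1,1\}),$$ where $dc$ denotes the counting measure on $\{\pm1\}$.
   Context: The signature representation of $\{\pm1\}$ is $\rho(x)=x$ (multiplication by $x\in\{\pm1\}$ on $\mathbb{R}$). The method: let $G$ be a Lie group with finitely many connected components, $H$ a closed subgroup, $X:=G/H$, $\rho\colon G\to GL(V)$ a continuous finite dimensional real representation and $v_0\in V$ an $H$-fixed vector. Put $W_0(G,H):=\{\tau\colon G\to\mathbb{R}\mid\tau\text{ is a continuous group homomorphism with }\tau|_H=0\}$. Take a nonzero relatively $G$-invariant Radon measure $\nu$ on $X$ (i.e. for some $\chi\colon G\to\mathbb{R}_{>0}$ the pushforward satisfies $g\cdot\nu=\chi(g)^{-1}\nu$ for all $g\in G$), assumed to exist; the resulting family does not depend on the choice of $\nu$. For $\theta=(\varphi,\tau)\in V^\vee\times W_0(G,H)$ and $x=gH$, put $\rho(x)v_0:=\rho(g)v_0$, $\tau(x):=\tau(g)$ and $d\tilde p_\theta(x):=\exp(-\langle\varphi,\rho(x)v_0\rangle+\tau(x))\,d\nu(x)$. Let $\Theta:=\{\theta\in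 V^\vee\times W_0(G,H)\mid\int_Xd\tilde p_\theta<\infty\}$ and, for $\theta\in\Theta$, $p_\theta:=(\int_Xd\tilde p_\theta)^{-1}\tilde p_\theta$. The family obtained is the set $\mathcal{P}:=\{p_\theta\}_{\theta\in\Theta}$ of probability measures on $X$. *)

(* Defs.v *)
From HB Require Import structures.
From mathcomp Require Import all_boot all_order all_algebra.
From mathcomp Require Import generic_quotient.
From mathcomp Require Import all_classical all_reals all_analysis.

Set Implicit Arguments.
Unset Strict Implicit.
Unset Printing Implicit Defensive.

Import Order.TTheory GRing.Theory Num.Theory.
Import numFieldNormedType.Exports.

Local Open Scope classical_set_scope.
Local Open Scope ring_scope.
Local Open Scope quotient_scope.

(* The construction below uses of a Lie group only its underlying topological
   group. *)
HB.mixin Record isTopologicalGroup (G : Type) of Group G & Topological G := {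
  mulg_continuous : continuous (fun xy : G * G => (xy.1 * xy.2)%g) ;
  invg_continuous : continuous (fun x : G => x^-1%g) }.

#[short(type="topologicalGroupType")]
HB.structure Definition TopologicalGroup :=
  { G of isTopologicalGroup G & Group G & Topological G }.

Section CosetSpace.
Variables (G : topologicalGroupType) (H : set G).

Definition closed_subgroup : Prop :=
  [/\ H 1%g, forall x y, H x -> H y -> H (x * y)%g,
      forall x, H x -> H x^-1%g & closed H].

Definition left_coset (g : G) : set G := [set (g * h)%g | h in H].

Definition same_coset (g g' : G) : bool := `[< left_coset g = left_coset g' >].

Lemma same_coset_class : equiv_class_of same_coset.
Proof.
split=> [x|x y|y x z]; rewrite /same_coset.
- exact/asboolP.
- by apply/asboolP/asboolP => ->.
- by move=> /asboolP -> /asboolP ->; apply/asboolP.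
Qed.

Canonical same_coset_equiv := EquivRelPack same_coset_class.

Definition coset_space := quotient_topology {eq_quot same_coset_equiv}.

HB.instance Definition _ := Quotient.on coset_space.
HB.instance Definition _ := Topological.on coset_space.
HB.instance Definition _ :=
  isPointed.Build coset_space (\pi_coset_space 1%g : coset_space).

Definition coset_act (g : G) (x : coset_space) : coset_space :=
  \pi_coset_space (g * repr x)%g.

End CosetSpace.

Notation borel X := (g_sigma_algebraType (@open X)).

Section Method.
Variables (R : realType) (G : topologicalGroupType) (H : set G).
Local Notation X := (coset_space H).

Definition radon_measure (nu : {measure set (borel X) -> \bar R}) : Prop :=
  [/\ forall K : set X, compact K -> (nu K < +oo)%E,
      forall A : set (borel X), measurable A ->
        nu A = ereal_inf [set nu U | U in [set U : set X | open U /\ A `<=` U]]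
    & forall U : set X, open U ->
        nu U = ereal_sup
          [set nu K | K in [set K : set X | compact K /\ K `<=` U]] ].

Definition relatively_invariant (nu : {measure set (borel X) -> \bar R}) :
    Prop :=
  exists2 chi : G -> R, (forall g, 0 < chi g) &
    forall (g : G) (A : set (borel X)), measurable A ->
      pushforward nu (coset_act g : borel X -> borel X) A =
        ((chi g)^-1%:E * nu A)%E.

Definition admissible_measure (nu : {measure set (borel X) -> \bar R}) : Prop :=
  [/\ nu [set: X] != 0%E, radon_measure nu & relatively_invariant nu].

Variable V : vectType R.

(* The first two clauses make rho a group morphism into GL(V); the third
   is continuity of its matrix in a basis of V. *)
Definition continuous_representation (rho : G -> 'End(V)) : Prop :=
  [/\ rho 1%g = \1%VF,
      forall g h, rho (g * h)%g = (rho g \o rho h)%VF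
    & continuous (fun g => passmx.mxof (vbasis {:V}) (vbasis {:V}) (rho g))].

Definition fixed_vector (rho : G -> 'End(V)) (v0 : V) : Prop :=
  forall h, H h -> rho h v0 = v0.

Definition W0 : set (G -> R) :=
  [set tau | [/\ continuous tau,
                 forall g h, tau (g * h)%g = tau g + tau h
               & forall h, H h -> tau h = 0] ].

Variables (rho : G -> 'End(V)) (v0 : V).
Variable nu : {measure set (borel X) -> \bar R}.

(* Both terms are constant on cosets when v0 is H-fixed and tau is in W0, so
   the choice of the representative is immaterial. *)
Definition density (theta : 'Hom(V, R^o) * (G -> R)) (x : X) : R :=
  expR (- (theta.1 (rho (repr x) v0) : R) + theta.2 (repr x)).

Definition ptilde (theta : 'Hom(V, R^o) * (G -> R)) (A : set (borel X)) :
    \bar R :=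
  (\int[nu]_(x in A) (density theta x)%:E)%E.

Definition Theta : set ('Hom(V, R^o) * (G -> R)) :=
  [set theta | W0 theta.2 /\ (ptilde theta [set: X] < +oo)%E].

Definition ptheta (theta : 'Hom(V, R^o) * (G -> R)) (A : set (borel X)) : \bar R :=
  ((fine (ptilde theta [set: X]))^-1%:E * ptilde theta A)%E.

Definition method_family : set (probability (borel X) R) :=
  [set P : probability (borel X) R | exists2 theta, Theta theta &
    forall A : set (borel X), measurable A -> P A = ptheta theta A].

End Method.

Section SignGroup.
Variable R : realType.

Record sign := Sign { sign_val :> R ; _ : sign_val \in [:: 1; -1] }.

HB.instance Definition _ := [isSub for sign_val].
HB.instance Definition _ := [Choice of sign by <:].

Lemma sign_cases (x : sign) : (x : R) = 1 \/ (x : R) = -1.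
Proof. by have := valP x; rewrite !inE => /orP[] /eqP; [left|right]. Qed.

Lemma sign1_subproof : (1 : R) \in [:: 1; -1].
Proof. by rewrite !inE eqxx. Qed.

Lemma signM_subproof (x y : sign) : (x : R) * (y : R) \in [:: 1; -1].
Proof.
by rewrite !inE; case: (sign_cases x) (sign_cases y) => -> [] ->;
  rewrite ?mulrNN ?mulr1 ?mul1r ?eqxx ?orbT.
Qed.

Definition sign1 : sign := Sign sign1_subproof.
Definition signM (x y : sign) : sign := Sign (signM_subproof x y).

Lemma signMA : associative signM.
Proof. by move=> x y z; apply/val_inj/mulrA. Qed.

Lemma sign1M : left_id sign1 signM.
Proof. by move=> x; apply/val_inj/mul1r. Qed.

Lemma signM1 : right_id sign1 signM.
Proof. by move=> x; apply/val_inj/mulr1. Qed.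

Lemma signMV : left_inverse sign1 id signM.
Proof.
by move=> x; apply/val_inj => /=; case: (sign_cases x) => ->;
  rewrite ?mulrNN mulr1.
Qed.

HB.instance Definition _ := isGroup.Build sign signMA sign1M signM1 signMV signMV.

HB.instance Definition _ := isPointed.Build sign sign1.
HB.instance Definition _ := hasNbhs.Build sign principal_filter.
HB.instance Definition _ := Discrete_ofNbhs.Build sign erefl.

Lemma signM_continuous :
  continuous (fun xy : sign * sign => (xy.1 * xy.2)%g).
Proof.
move=> [x y] A /= xyA.
exists ([set x], [set y]); first by split; exact: discrete_set1.
by move=> [u v] [/= -> ->]; exact: nbhs_singleton xyA.
Qed.

Lemma signV_continuous : continuous (fun x : sign => x^-1%g).
Proof. by move=> x A xA. Qed.

HB.instance Definition _ :=
  isTopologicalGroup.Build sign signM_continuous signV_continuous.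

Definition signature_rep (x : sign) : 'End(R^o) := (x : R) *: \1%VF.

Definition trivial_subgroup : set sign := [set 1%g].

Local Notation X := (coset_space trivial_subgroup).

Definition sign_coset : sign -> X := \pi_X.

Lemma sign_coset_bij : bijective sign_coset.
Proof.
have inj : injective sign_coset.
  move=> x y /(@eqmodP _ (same_coset_equiv trivial_subgroup)) /asboolP xy.
  have : left_coset trivial_subgroup x x by exists 1%g => //; rewrite mulg1.
  by rewrite xy => -[_ ->]; rewrite mulg1.
exists repr; last exact: reprK.
by move=> x; apply: inj; exact: reprK.
Qed.

(* A measure on G/H, transported from {1, -1} along the bijection sign_coset. *)
Definition bernoulli_measure (s : R) (A : set (borel X)) : \bar R :=
  (\int[counting]_(x in (sign_coset @^-1` A : set (borel sign)))
     (s `^ ((1 + (x : R)) / 2) * (1 - s) `^ ((1 - (x : R)) / 2))%:E)%E.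

Definition bernoulli_family : set (probability (borel X) R) :=
  [set P : probability (borel X) R | exists2 s : R, 0 < s < 1 &
    forall A : set (borel X), measurable A -> P A = bernoulli_measure s A].

End SignGroup.

Arguments trivial_subgroup R : clear implicits.
Arguments signature_rep R x : clear implicits.
Arguments bernoulli_family R : clear implicits.

(* Main.v *)
Require Import Defs.
From mathcomp Require Import all_boot all_order all_algebra.
From mathcomp Require Import all_classical all_reals all_analysis.
From mathcomp Require Import generic_quotient ring lra.
From mathcomp Require finmap.
Import numFieldNormedType.Exports.
Import Order.TTheory GRing.Theory Num.Theory.
Local Open Scope classical_set_scope.
Local Open Scope ring_scope.

(** A relatively invariant Radon measure on the two-point space G/H has equal
    finite positive masses at both points: moving by -1 swaps them while scaling
    by some k > 0, so k^2 = 1. Since -1 has order two, every tau in W_0(G,H)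
    vanishes. Hence p_theta depends only on phi, and puts mass
    s = e^{-phi(1)} / (e^{-phi(1)} + e^{phi(1)}) on 1; as phi(1) runs through
    the reals, s runs through (0,1). *)

(** Cut [A] into its traces on [{a}] and [{b}]: on each the integrand is constant, and the trace is
    the whole point or empty, which the factors [(a \in A)%:R] and [(b \in A)%:R] record. It serves
    both the counting measure on the group and [nu] on the coset space. *)
Lemma ge0_integral_two_points (d : measure_display) (T : measurableType d)
    (R : realType) (mu : {measure set T -> \bar R}) (a b : T) (f : T -> R)
    (A : set T) :
  a != b -> (forall x, x = a \/ x = b) -> (forall B : set T, measurable B) ->
  (forall x, 0 <= f x) ->
  (\int[mu]_(x in A) (f x)%:E =
     (f a * (a \in A)%:R)%:E * mu [set a] +
     (f b * (b \in A)%:R)%:E * mu [set b])%E.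
Proof.
move=> ab Tab mT f0.
have point x : (\int[mu]_(t in A `&` [set x]) (f t)%:E =
    (f x * (x \in A)%:R)%:E * mu [set x])%E.
  have [/set_mem xA|xA] := boolP (x \in A).
    have -> : A `&` [set x] = [set x].
      by apply/seteqP; split=> [t []//|t ->]; split.
    rewrite (eq_integral (cst (f x)%:E)); last by move=> t /set_mem ->.
    by rewrite integral_cst// mulr1.
  have -> : A `&` [set x] = set0.
    by apply/seteqP; split=> // t [tA tx]; move: xA; rewrite notin_setE -tx.
  by rewrite integral_set0 mulr0 mul0e.
have {1}-> : A = (A `&` [set a]) `|` (A `&` [set b]).
  apply/seteqP; split=> [x xA|x [[]|[]]//].
  by have [xE|xE] := Tab x; [left|right].
rewrite ge0_integral_setU ?point//.
- by move=> x _; rewrite lee_fin.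
- apply/disj_setPS => x [[_ /= ->] [_ /= ba]].
  by rewrite ba eqxx in ab.
Qed.

(** * Points and topology of the two-point coset space *)

Section SignCosets.
Variable R : realType.
Local Notation X := (coset_space (trivial_subgroup R)).

Lemma signN1_subproof : (-1 : R) \in [:: 1; -1].
Proof. by rewrite !inE eqxx orbT. Qed.

Definition signN1 : sign R := Sign signN1_subproof.

Lemma sign1_or_N1 (x : sign R) : x = sign1 R \/ x = signN1.
Proof. by case: (sign_cases x) => xE; [left|right]; exact/val_inj. Qed.

Lemma sign1_neqN1 : sign1 R != signN1.
Proof. by apply/eqP => /(congr1 (@sign_val R)) /=; lra. Qed.

Lemma repr_sign_coset (x : sign R) : repr (sign_coset x) = x.
Proof. by apply: (bij_inj (sign_coset_bij R)); exact: reprK. Qed.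

Lemma sign_coset_cases (x : X) :
  x = sign_coset (sign1 R) \/ x = sign_coset signN1.
Proof.
rewrite -[x]reprK -/(sign_coset (repr x)).
by case: (sign1_or_N1 (repr x)) => ->; [left|right].
Qed.

Lemma sign_coset1_neqN1 : sign_coset (sign1 R) != sign_coset signN1.
Proof. by rewrite (bij_eq (sign_coset_bij R)) sign1_neqN1. Qed.

Lemma coset_act_sign_coset (g x : sign R) :
  coset_act (g : sign R) (sign_coset x) = sign_coset (g * x)%g.
Proof. by rewrite /coset_act repr_sign_coset. Qed.

(** Openness in the quotient topology is openness of the preimage in the group, which is
    discrete. *)
Lemma open_coset_space (U : set X) : open U.
Proof. exact: (@discrete_open (sign R)). Qed.

Lemma measurable_borel_coset_space (A : set (borel X)) : measurable A.
Proof. by apply: sub_sigma_algebra; exact: open_coset_space. Qed.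

Lemma measurable_borel_sign (A : set (borel (sign R))) : measurable A.
Proof. by apply: sub_sigma_algebra; exact: discrete_open. Qed.

Lemma compact_coset_space (K : set X) : compact K.
Proof.
apply: finite_compact.
apply: (@sub_finite_set _ _ [set sign_coset (sign1 R); sign_coset signN1]).
  by move=> x _; exact: sign_coset_cases.
exact: finite_set2.
Qed.

(** * Admissible measures on the coset space *)

Lemma signN1_mul1 : (signN1 * sign1 R)%g = signN1.
Proof. exact: signM1. Qed.

Lemma signN1_mulN1 : (signN1 * signN1)%g = sign1 R.
Proof. exact: signMV. Qed.

(** Every subset is both open and compact, so the infimum and the supremum in the regularity
    conditions are attained at the set itself. *)
Lemma radon_measure_sign (nu : {measure set (borel X) -> \bar R}) :
  (nu [set: X] < +oo)%E -> radon_measure nu.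
Proof.
move=> nuT; split=> [K _|A _|U _].
- apply: le_lt_trans nuT; apply: le_measure => //;
    by rewrite inE; exact: measurable_borel_coset_space.
- apply/eqP; rewrite eq_le; apply/andP; split.
    apply: le_ereal_inf_tmp => _ [U [_ AU] <-]; apply: le_measure => //;
      by rewrite inE; exact: measurable_borel_coset_space.
  apply: ereal_inf_lbound; exists A => //.
  by split=> //; exact: open_coset_space.
- apply/eqP; rewrite eq_le; apply/andP; split.
    apply: ereal_sup_ubound; exists U => //.
    by split=> //; exact: compact_coset_space.
  apply: ge_ereal_sup => _ [K [_ KU] <-]; apply: le_measure => //;
    by rewrite inE; exact: measurable_borel_coset_space.
Qed.

(** The sum of the Dirac masses at the two cosets is invariant with [chi = 1], since the action only
    permutes them. This keeps the quantification over admissible measures from being vacuous. *)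
Lemma admissible_measure_sign_exists :
  exists nu : {measure set (borel X) -> \bar R}, admissible_measure nu.
Proof.
pose m1 : {measure set (borel X) -> \bar R} := \d_(sign_coset (sign1 R) : borel X).
pose m2 : {measure set (borel X) -> \bar R} := \d_(sign_coset signN1 : borel X).
pose nu : {measure set (borel X) -> \bar R} := measure_add m1 m2.
have nuE A : nu A =
    ((sign_coset (sign1 R) \in A)%:R + (sign_coset signN1 \in A)%:R)%:E.
  by rewrite [LHS]measure_addE /= !diracE.
exists nu; split.
- by rewrite nuE !in_setT eqe -natrD pnatr_eq0.
- by apply: radon_measure_sign; rewrite nuE ltry.
exists (fun=> 1) => // g A _.
rewrite invr1 mul1e /pushforward !nuE; congr EFin.
have preimageE x : (sign_coset x \in coset_act g @^-1` A) =
    (sign_coset (g * x)%g \in A).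
  by rewrite -coset_act_sign_coset; apply/idP/idP => /set_mem ?; apply/mem_set.
rewrite !preimageE; case: (sign1_or_N1 g) => ->.
  by rewrite !mul1g.
by rewrite signN1_mul1 signN1_mulN1 addrC.
Qed.

Lemma admissible_measure_sign_uniform (nu : {measure set (borel X) -> \bar R}) :
  admissible_measure nu -> exists2 c : R, 0 < c &
    nu [set sign_coset (sign1 R)] = c%:E /\ nu [set sign_coset signN1] = c%:E.
Proof.
case=> nuT [nufin _ _] [chi chi0 nuchi].
set x1 := sign_coset (sign1 R); set x2 := sign_coset signN1.
(* Points are compact, so a Radon measure gives them finite mass and the computation can move to
   [R]. *)
have finE x : nu [set x] = (fine (nu [set x]))%:E.
  rewrite fineK// ge0_fin_numE//; apply: nufin; exact: compact_set1.
have swap1 : coset_act signN1 @^-1` [set x1] = [set x2].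
  apply/seteqP; split=> [x|x ->] /=; last first.
    by rewrite coset_act_sign_coset signN1_mulN1.
  case: (sign_coset_cases x) => ->//.
  rewrite coset_act_sign_coset signN1_mul1 => /eqP.
  by rewrite eq_sym (negbTE sign_coset1_neqN1).
have swap2 : coset_act signN1 @^-1` [set x2] = [set x1].
  apply/seteqP; split=> [x|x ->] /=; last first.
    by rewrite coset_act_sign_coset signN1_mul1.
  case: (sign_coset_cases x) => ->//.
  rewrite coset_act_sign_coset signN1_mulN1 => /eqP.
  by rewrite (negbTE sign_coset1_neqN1).
(* Testing invariance under -1 on each point yields [a = k * b] and [b = k * a], where [k] is the
   inverse of [chi signN1]. *)
have := nuchi signN1 _ (measurable_borel_coset_space [set x1]).
have := nuchi signN1 _ (measurable_borel_coset_space [set x2]).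
rewrite /pushforward swap1 swap2 (finE x1) (finE x2) -!EFinM => -[e1] [e2].
set a := fine (nu [set x1]) in e1 e2 *; set b := fine (nu [set x2]) in e1 e2 *.
have a0 : 0 <= a by rewrite fine_ge0.
have k0 : 0 < (chi signN1)^-1 by rewrite invr_gt0.
move: (_^-1) k0 e1 e2 => k k0 e1 e2.
(* If [a = 0] then [b = k * a = 0] too, so [nu] would vanish on the whole space. *)
have [az|an0] := eqVneq a 0.
  suff nuT0 : nu [set: X] = (nu [set x1] + nu [set x2])%E.
    by move: nuT; rewrite nuT0 finE (finE x2) -/a -/b e2 az mulr0 adde0 eqxx.
  have -> : [set: X] = [set x1] `|` [set x2].
    by apply/seteqP; split=> // x _; exact: sign_coset_cases.
  apply: measureU; do ?exact: measurable_borel_coset_space.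
  apply/seteqP; split=> // x [-> /= /eqP].
  by rewrite (negbTE sign_coset1_neqN1).
have k1 : k = 1.
  have kk : k * k = 1 by apply: (mulIf an0); rewrite mul1r -mulrA -e2 -e1.
  nra.
by exists a; rewrite ?lt_neqAle ?a0 ?andbT 1?eq_sym// e2 k1 mul1r.
Qed.

(** * Explicit weights of both families *)

Lemma W0_sign (tau : sign R -> R) : W0 (trivial_subgroup R) tau -> tau = cst 0.
Proof.
case=> _ tauM tau1; apply/funext => x /=.
have tau1E : tau (sign1 R) = 0 by exact: tau1.
case: (sign1_or_N1 x) => ->//.
have := tauM signN1 signN1; rewrite signN1_mulN1 tau1E; lra.
Qed.

Lemma bernoulli_measureE (s : R) (A : set (borel X)) : 0 < s < 1 ->
  bernoulli_measure s A =
    (s * (sign_coset (sign1 R) \in A)%:R +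
     (1 - s) * (sign_coset signN1 \in A)%:R)%:E.
Proof.
move=> /andP[s0 s1].
(* Counting is repackaged as a measure on the Borel sets of the group, so that the two-point formula
   applies. *)
pose cnt : {measure set (borel (sign R)) -> \bar R} := counting.
have cnt1 x : cnt [set x] = 1%:E.
  by rewrite /cnt /= /counting asboolT// fset_set1 finmap.cardfs1.
rewrite /bernoulli_measure (@ge0_integral_two_points _ _ _ cnt
  (sign1 R : borel (sign R)) signN1).
- rewrite !cnt1 !mule1 -EFinD /=.
  (* At 1 and -1 the exponents are only 0 or 1, so the real powers reduce to [s] and [1 - s]. *)
  have -> : (1 + 1) / 2 = 1 :> R by lra.
  have -> : (1 + -1) / 2 = 0 :> R by lra.
  have -> : (1 - -1) / 2 = 1 :> R by lra.
  by rewrite !powRr0 !powRr1 ?mul1r ?mulr1 ?subr_ge0// ltW.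
- exact: sign1_neqN1.
- exact: sign1_or_N1.
- exact: measurable_borel_sign.
- by move=> x; rewrite mulr_ge0// powR_ge0.
Qed.

(** The constant [c] is the common mass of the two points. By linearity of [phi], the density is
    [expR (- phi 1)] at 1 and [expR (phi 1)] at -1. *)
Lemma ptilde_signE (nu : {measure set (borel X) -> \bar R})
    (phi : 'Hom(R^o, R^o)) : admissible_measure nu ->
  exists2 c : R, 0 < c & forall A : set (borel X),
  ptilde (signature_rep R) (1 : R^o) nu (phi, cst 0) A =
    (c * (expR (- phi 1) * (sign_coset (sign1 R) \in A)%:R +
          expR (phi 1) * (sign_coset signN1 \in A)%:R))%:E.
Proof.
move=> /admissible_measure_sign_uniform[c c0 [nu1 nu2]].
exists c => // A.
rewrite /ptilde (@ge0_integral_two_points _ _ _ _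
  (sign_coset (sign1 R) : borel X) (sign_coset signN1)).
- rewrite nu1 nu2 -!EFinM -EFinD; congr EFin.
  rewrite /density /signature_rep !repr_sign_coset /= !lfunE /= !lfunE /=.
  rewrite scale1r scaleN1r linearN opprK !addr0; ring.
- exact: sign_coset1_neqN1.
- exact: sign_coset_cases.
- exact: measurable_borel_coset_space.
- by move=> x; exact: expR_ge0.
Qed.

Lemma Theta_sign (nu : {measure set (borel X) -> \bar R})
    (phi : 'Hom(R^o, R^o)) : admissible_measure nu ->
  Theta (signature_rep R) (1 : R^o) nu (phi, cst 0).
Proof.
move=> nu_adm; split=> /=; first by split=> [||h _]//=; [exact: cst_continuous|rewrite addr0].
by have [c _ ->] := ptilde_signE _ phi nu_adm; rewrite ltry.
Qed.

(** Normalisation cancels the constant [c], the only trace of [nu] in [ptilde]. *)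
Lemma ptheta_signE (nu : {measure set (borel X) -> \bar R})
    (phi : 'Hom(R^o, R^o)) (s : R) (A : set (borel X)) :
  admissible_measure nu ->
  s = expR (- phi 1) / (expR (- phi 1) + expR (phi 1)) ->
  ptheta (signature_rep R) (1 : R^o) nu (phi, cst 0) A = bernoulli_measure s A.
Proof.
move=> nu_adm sE; have e1 := expR_gt0 (- phi 1); have e2 := expR_gt0 (phi 1).
have s01 : 0 < s < 1.
  by rewrite sE divr_gt0 ?addr_gt0//= ltr_pdivrMr ?addr_gt0// mul1r ltrDl.
rewrite bernoulli_measureE// /ptheta.
have [c c0 pE] := ptilde_signE _ phi nu_adm.
rewrite !pE !in_setT -EFinM /= !mulr1 sE; congr EFin.
by field; rewrite !gt_eqF// addr_gt0.
Qed.

Lemma signature_rep_continuous :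
  continuous_representation (signature_rep R).
Proof.
split=> [|g h|].
- by apply/lfunP => x; rewrite lfunE /= scale1r.
- apply/lfunP => x; rewrite /signature_rep.
  by rewrite !lfunE /= !lfunE /= !lfunE /= scalerA.
(* In a discrete group [{x}] is a neighbourhood of [x], which makes any map continuous there. *)
- by move=> x A /nbhs_singleton xA; apply: (filterS _ (discrete_set1 x)) => _ ->.
Qed.

Lemma method_family_sign (nu : {measure set (borel X) -> \bar R}) :
  admissible_measure nu ->
  method_family (signature_rep R) (1 : R^o) nu = bernoulli_family R.
Proof.
move=> nu_adm; apply/seteqP; split=> P.
  case=> -[phi tau] [/= /W0_sign -> _] PE.
  have e1 := expR_gt0 (- phi 1); have e2 := expR_gt0 (phi 1).
  exists (expR (- phi 1) / (expR (- phi 1) + expR (phi 1))).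
    by rewrite divr_gt0 ?addr_gt0//= ltr_pdivrMr ?addr_gt0// mul1r ltrDl.
  by move=> A mA; rewrite PE// (ptheta_signE _ _ _ _ nu_adm erefl).
case=> s /andP[s0 s1] PE.
(* The weights at 1 and -1 have ratio [expR (- 2 * phi 1)]; equating it with [s / (1 - s)] and
   taking logarithms gives this slope. *)
pose phi : 'Hom(R^o, R^o) := ((ln (1 - s) - ln s) / 2) *: \1%VF.
have phi1 : phi 1 = (ln (1 - s) - ln s) / 2 :> R.
  by rewrite lfunE /= lfunE /= [LHS]mulr1.
have s1' : 0 < 1 - s by rewrite subr_gt0.
have phiE : expR (phi 1) * s = expR (- phi 1) * (1 - s).
  rewrite -{1}(lnK s0) -{1}(lnK s1') -!expRD phi1; congr expR; lra.
exists (phi, cst 0); first exact: Theta_sign.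
move=> A mA; rewrite PE//; apply/esym/ptheta_signE => //.
have e1 := expR_gt0 (- phi 1); have e2 := expR_gt0 (phi 1).
(* Once the denominator is cleared, the formula for [s] is a linear consequence of [phiE]. *)
apply: (canRL (mulfK _)); first by rewrite gt_eqF// addr_gt0.
lra.
Qed.
End SignCosets.

Theorem proposition4p5 (R : realType) :
  [/\ closed_subgroup (trivial_subgroup R),
      continuous_representation (signature_rep R),
      fixed_vector (trivial_subgroup R) (signature_rep R) (1 : R^o),
      (exists nu : {measure set (borel (coset_space (trivial_subgroup R))) ->
                      \bar R}, admissible_measure nu)
    & forall nu : {measure set (borel (coset_space (trivial_subgroup R))) ->
                     \bar R},
        admissible_measure nu ->
        method_family (signature_rep R) (1 : R^o) nu = bernoulli_family R].
Proof.
split.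
- split; [by []|by move=> x y -> ->; exact: mulg1|by move=> x ->|].
  exact: discrete_closed.
- exact: signature_rep_continuous.
- by move=> h ->; rewrite lfunE /= lfunE /= scale1r.
- exact: admissible_measure_sign_exists.
- exact: method_family_sign.
Qed.
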